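(* Let $\mathcal{G}$ be a class of (simple) graphs that is closed under contraction of edges and under the attachment of pendant edges. Then \[ \chi_f(\mathcal{G}) \le \limsup_{\Delta\to\infty} \frac{\chi_2'(\mathcal{G},\Delta)}{\Delta} \le \chi(\mathcal{G}). \]
   Context: A strong edge-colouring of a graph $G$ is a partition of its edge set into induced matchings of $G$. The strong chromatic index $\chi_2'(G)$ is the least number of parts in such a partition; equivalently $\chi_2'(G)=\chi(L(G)^2)$, the chromatic number of the square of the line graph of $G$. The fractional chromatic number $\chi_f(G)$ is the least total weight of a function $w:\mathcal{I}(G)\to\mathbb{R}^+$ on the stable sets of $G$ such that $\sum_{S\ni v} w(S)\ge 1$ for every vertex $v$. For a class $\mathcal{G}$ of graphs, $\chi(\mathcal{G})$ (resp. $\chi_f(\mathcal{G})$) denotes the largest chromatic number (resp. fractional chromatic number) over graphs in $\mathcal{G}$, and $\chi_2'(\mathcal{G},\Delta)$ denotes the largest strong chromatic index over graphs in $\mathcal{G}$ of maximum degree $\Delta$. *)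

(* Defs.v *)
From HB Require Import structures.
From mathcomp Require Import all_boot all_order all_algebra.
From mathcomp Require Import boolp classical_sets.
From mathcomp Require Import reals constructive_ereal ereal sequences.

Set Implicit Arguments.
Unset Strict Implicit.
Unset Printing Implicit Defensive.

Import Order.TTheory GRing.Theory Num.Theory.

Record sgraph := SGraph {
  vertex :> finType;
  adj : rel vertex;
  adj_sym : symmetric adj;
  adj_irrefl : irreflexive adj }.

Arguments adj {s}.

Definition graph_iso (G H : sgraph) : Prop :=
  exists2 f : G -> H, bijective f & forall x y, adj (f x) (f y) = adj x y.

(* A plain predicate: [set sgraph] is a universe inconsistency. *)
Definition graph_class := sgraph -> Prop.

(** * Contraction and pendant edges *)

Section Contraction.
Variables (G : sgraph) (x y : G).
Hypothesis xy : adj x y.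

Definition contract_vertex := {v : G | v != y}.

Lemma contract_neq : x != y.
Proof. by apply: contraTneq xy => ->; rewrite adj_irrefl. Qed.

(* Sends [y] to [x] and fixes every other vertex, so [y] is merged into [x];
   loops and parallel edges disappear. *)
Definition contract_map (v : G) : contract_vertex :=
  insubd (exist _ x contract_neq : contract_vertex) v.

Definition contract_adj : rel contract_vertex := fun a b =>
  (a != b) &&
  [exists u, exists v,
    [&& adj u v, contract_map u == a & contract_map v == b]].

Fact contract_adj_sym : symmetric contract_adj.
Proof.
move=> a b; rewrite /contract_adj eq_sym; congr (_ && _).
apply/existsP/existsP => -[u /existsP[v /and3P[uv ua vb]]];
  by exists v; apply/existsP; exists u; rewrite adj_sym uv ua vb.
Qed.

Fact contract_adj_irrefl : irreflexive contract_adj.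
Proof. by move=> a; rewrite /contract_adj eqxx. Qed.

Definition contract_edge : sgraph := SGraph contract_adj_sym contract_adj_irrefl.

End Contraction.

Section Pendant.
Variables (G : sgraph) (x : G).

(* [None] is the new leaf, attached to [x]. *)
Definition pendant_adj : rel (option G) := fun a b =>
  match a, b with
  | Some u, Some v => adj u v
  | Some u, None | None, Some u => u == x
  | None, None => false
  end.

Fact pendant_adj_sym : symmetric pendant_adj.
Proof. by move=> [u|] [v|] //=; rewrite adj_sym. Qed.

Fact pendant_adj_irrefl : irreflexive pendant_adj.
Proof. by move=> [u|] //=; rewrite adj_irrefl. Qed.

Definition attach_pendant : sgraph :=
  SGraph pendant_adj_sym pendant_adj_irrefl.

End Pendant.

Definition iso_closed (C : graph_class) : Prop :=
  forall G H : sgraph, graph_iso G H -> C G -> C H.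

Definition contraction_closed (C : graph_class) : Prop :=
  forall (G : sgraph) (x y : G) (xy : adj x y), C G -> C (contract_edge xy).

Definition pendant_closed (C : graph_class) : Prop :=
  forall (G : sgraph) (x : G), C G -> C (attach_pendant x).

(** * Graph invariants *)

Section Invariants.
Variable G : sgraph.

Definition max_degree : nat := (\max_(x : G) #|[set y | adj x y]%SET|)%N.

Definition stable (S : {set G}) : bool :=
  [forall x in S, forall y in S, ~~ adj x y].

Definition proper_colouring k (f : {ffun G -> 'I_k}) : bool :=
  [forall x, forall y, adj x y ==> (f x != f y)].

Definition colourable (k : nat) : bool :=
  [exists f : {ffun G -> 'I_k}, proper_colouring f].

Lemma colourable_ex : exists k, colourable k.
Proof.
exists #|G|; apply/existsP; exists [ffun x => enum_rank x].
apply/forallP => x; apply/forallP => y; apply/implyP => xy.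
rewrite !ffunE (inj_eq enum_rank_inj).
by apply: contraTneq xy => ->; rewrite adj_irrefl.
Qed.

Definition chromatic_number : nat := ex_minn colourable_ex.

Definition edges : {set {set G}} :=
  [set e : {set G} | [exists x, exists y, adj x y && (e == [set x; y]%SET)]]%SET.

Definition induced_matching (M : {set {set G}}) : bool :=
  [&& M \subset edges, finset.trivIset M &
      [forall e in edges, (e \subset finset.cover M) ==> (e \in M)]].

Definition strong_edge_colouring (P : {set {set {set G}}}) : bool :=
  finset.partition P edges && [forall M in P, induced_matching M].

Definition strong_edge_colourable (k : nat) : bool :=
  [exists P : {set {set {set G}}}, strong_edge_colouring P && (#|P| == k)].

Lemma strong_edge_colourable_ex : exists k, strong_edge_colourable k.
Proof.
pose P := [set [set e]%SET | e in edges]%SET.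
exists #|P|; apply/existsP; exists P; rewrite eqxx andbT.
have card2 e : e \in edges -> #|e| = 2.
  rewrite inE => /existsP[x /existsP[y /andP[xy /eqP->]]].
  by rewrite cards2 (contract_neq xy).
apply/andP; split.
  apply/and3P; split.
  - apply/eqP/setP => e; apply/bigcupP/idP.
      by move=> [M /imsetP[f fE ->]]; rewrite inE => /eqP->.
    by move=> eE; exists [set e]%SET; rewrite ?set11 ?imset_f.
  - apply/finset.trivIsetP => A B /imsetP[e _ ->] /imsetP[f _ ->] nef.
    rewrite disjoints1 inE; apply: contraNneq nef => ->; exact: eqxx.
  - by apply/imsetP => -[e _ /setP/(_ e)]; rewrite !inE eqxx.
apply/forallP => M; apply/implyP => /imsetP[e eE ->].
apply/and3P; split.
- by rewrite finset.sub1set.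
- by apply/finset.trivIsetP => A B; rewrite !inE => /eqP-> /eqP->; rewrite eqxx.
- apply/forallP => f; apply/implyP => fE; apply/implyP.
  by rewrite /finset.cover big_set1 inE eqEcard => ->; rewrite !card2.
Qed.

Definition strong_chromatic_index : nat := ex_minn strong_edge_colourable_ex.

End Invariants.

Local Open Scope classical_set_scope.
Local Open Scope ring_scope.
Local Open Scope ereal_scope.

Section Fractional.
Variable R : realType.

Definition fractional_colouring (G : sgraph) (w : {set G} -> R) : Prop :=
  (forall S, stable S -> 0 <= w S)%R /\
  (forall v : G, 1 <= \sum_(S : {set G} | stable S && (v \in S)) w S)%R.

Definition fractional_chromatic_number (G : sgraph) : \bar R :=
  ereal_inf [set (\sum_(S : {set G} | stable S) w S)%R%:E |
             w in @fractional_colouring G].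

(** * Largest values over a class *)

(* Supremum in [0, +oo]: the value is +oo if the invariant is unbounded on [C],
   and 0 (not -oo) if no graph is in [C]. *)
Definition largest (C : graph_class) (f : sgraph -> \bar R) : \bar R :=
  maxe 0 (ereal_sup [set x | exists2 G, C G & x = f G]).

Definition class_chi (C : graph_class) : \bar R :=
  largest C (fun G => (chromatic_number G)%:R%:E).

Definition class_chi_f (C : graph_class) : \bar R :=
  largest C fractional_chromatic_number.

Definition class_chi2 (C : graph_class) (D : nat) : \bar R :=
  largest (fun G => C G /\ max_degree G = D)
          (fun G => (strong_chromatic_index G)%:R%:E).

End Fractional.

Arguments class_chi : clear implicits.
Arguments class_chi_f : clear implicits.
Arguments class_chi2 : clear implicits.

(* Main.v *)
Require Import Defs.
From mathcomp Require Import all_boot all_order all_algebra perm.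
From mathcomp Require Import reals constructive_ereal ereal sequences.
From mathcomp Require Import zify.

Set Implicit Arguments.
Unset Strict Implicit.
Unset Printing Implicit Defensive.

Import Order.TTheory GRing.Theory Num.Theory.

(* Upper bound: by Vizing's theorem a graph G of maximum degree D splits into
   D + 1 matchings. Contracting a matching M gives a graph of the class, and a
   proper colouring of it splits M into induced matchings, since two edges of M
   whose contracted vertices are non-adjacent are not joined by an edge; hence
   (D + 1) chi colours suffice.

   Lower bound: attach t pendant edges to every vertex of G. In a strong
   edge-colouring the set of vertices of G that have a pendant edge of a given
   colour is stable, and every vertex belongs to t of these sets, so giving each
   of them weight 1/t yields a fractional colouring of G.

   Vizing's theorem is proved by adding the vertices one at a time, following
   Schrijver: Kempe exchanges balance the numbers of neighbours of the new
   vertex v missed by each colour until some colour is missed by exactly one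
   available neighbour u; that colour is given to uv and then set aside. *)

(** * Vizing's theorem *)

Section Kempe.
Variable T : finType.
Implicit Types (a b : T -> T) (A B P : {set T}).

Definition preserves a P := forall x, (a x \in P) = (x \in P).

(* Along the orbit of [x] under [b \o a], both [a] and [b] reverse the exponents,
   and a reflection of a cycle fixes at most two points. *)
Lemma alternating_orbit a b x : involutive a -> involutive b -> a x = x ->
  exists P, [/\ x \in P, preserves a P, preserves b P &
    #|[set y in P | a y == y]| + #|[set y in P | b y == y]| <= 2].
Proof.
move=> aI bI ax; pose f y := b (a y).
have injf : injective f by apply: inj_comp; exact: inv_inj.
pose n := fingraph.order f x.
have itn : iter n f x = x by exact: iter_order.
have n_gt0 : 0 < n by exact: fingraph.order_gt0.
have iter_inj l m : l < n -> m < n -> iter l f x = iter m f x -> l = m.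
  by move=> ln mn e; rewrite -(findex_iter ln) -(findex_iter mn) e.
have am m : m <= n -> a (iter m f x) = iter (n - m) f x.
  elim: m => [|m IH] mn; first by rewrite subn0 itn.
  apply: injf; rewrite -iterS subnSK // -IH; last exact: ltnW.
  by rewrite /f /= /f aI bI.
have bm m : m <= n -> b (iter m f x) = iter (n - m).+1 f x.
  by move=> mn; rewrite iterS -am // /f aI.
pose P := [set y | fconnect f x y].
have PE y : y \in P -> exists2 m, m < n & y = iter m f x.
  by rewrite inE => xy; exists (findex f x y); rewrite ?findex_max ?iter_findex.
have iterP m : iter m f x \in P by rewrite inE fconnect_iter.
have closedP c : involutive c -> (forall y, y \in P -> c y \in P) -> preserves c P.
  by move=> cI cP y; apply/idP/idP => /cP; rewrite ?cI.
exists P; split.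
- by rewrite inE connect0.
- by apply: closedP => // y /PE[m mn ->]; rewrite am // ltnW.
- by apply: closedP => // y /PE[m mn ->]; rewrite bm // ltnW.
(* Modulo [n], the exponent [m] is fixed by [a] iff [2m = 0] and by [b] iff [2m = 1]: at most one
   point each for odd [n], two for [a] and none for [b] for even [n]. *)
have fixa : [set y in P | a y == y] \subset
    if odd n then [set x] else [set x; iter n./2 f x].
  apply/subsetP => y; rewrite !inE => /andP[xy].
  have /PE[m mn ->] : y \in P by rewrite inE.
  rewrite am ?(ltnW mn) // => /eqP e.
  case: (posnP m) => [-> | m0]; first by case: ifP; rewrite !inE eqxx.
  have e2 : n - m = m by apply: iter_inj e; lia.
  have ->  : odd n = false by lia.
  have -> : n./2 = m by lia.
  by rewrite !inE eqxx orbT.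
have fixb : [set y in P | b y == y] \subset
    if odd n then [set iter n.+1./2 f x] else set0.
  apply/subsetP => y; rewrite !inE => /andP[xy].
  have /PE[m mn ->] : y \in P by rewrite inE.
  rewrite bm ?(ltnW mn) // => /eqP.
  (* The exponent [(n - m).+1] is below [n] only for [m > 1]; the values 0 and 1 of [m] wrap around
     the cycle. *)
  case: (posnP m) => [m0 | m0].
    rewrite m0 subn0 iterS itn => e.
    have n1 : n = 1.
      case: (ltngtP n 1) => //; first by lia.
      by move=> n1; have := @iter_inj 1 0 n1 n_gt0 e.
    by rewrite n1 /= inE eq_sym; apply/eqP.
  case: (ltngtP m 1) => [|m1|m1]; first by lia.
    move=> e; have e2 : (n - m).+1 = m by apply: iter_inj e; lia.
    have -> : odd n by lia.
    have -> : n.+1./2 = m by lia.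
    by rewrite inE eqxx.
  rewrite m1 subnS subn0 prednK // itn => e.
  have n1 : 1 < n by rewrite -m1.
  by have := @iter_inj 0 1 n_gt0 n1 e.
move: (subset_leq_card fixa) (subset_leq_card fixb).
case: (odd n); rewrite ?cards1 ?cards0 ?cards2 => ha hb; first lia.
by apply: leq_trans (leq_add ha hb) _; case: eqP.
Qed.

(** Take a minimal preserved [P] on which [A] outnumbers [B], and the alternating orbit [Q] of a
    point of [A :&: P]. If [P :&: Q] did not carry the excess, [P :\: Q] would, against minimality;
    and [a] fixes at most two points of [Q]. *)
Lemma kempe_excess a b A B : involutive a -> involutive b ->
    (forall x, x \in A -> a x = x) -> (forall x, x \in B -> b x = x) ->
    #|B| < #|A| ->
  exists P, [/\ preserves a P, preserves b P &
    #|B :&: P| < #|A :&: P| <= 2].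
Proof.
move=> aI bI fA fB ltBA.
pose good P := [&& [forall x, (a x \in P) == (x \in P)],
  [forall x, (b x \in P) == (x \in P)] & #|B :&: P| < #|A :&: P|].
have [|P /minsetP[]] := @minset_exists _ good setT.
  rewrite /good !setIT ltBA andbT.
  by apply/andP; split; apply/forallP => x; rewrite !inE.
case/and3P => /'forall_eqP Pa /'forall_eqP Pb ltP minP _.
have [|x] := @set0Pn _ (A :&: P) _.
  by rewrite -card_gt0; apply: leq_ltn_trans ltP.
rewrite inE => /andP[xA xP].
have [Q [xQ Qa Qb Q2]] := alternating_orbit aI bI (fA x xA).
case: (ltnP #|B :&: (P :&: Q)| #|A :&: (P :&: Q)|) => [lt|le].
  exists (P :&: Q); split; try by move=> y; rewrite !inE ?Pa ?Pb ?Qa ?Qb.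
  rewrite lt; apply: leq_trans Q2; apply: leq_trans (leq_addr _ _).
  apply: subset_leq_card; apply/subsetP => y; rewrite !inE.
  by case/and3P => yA _ ->; rewrite fA /=.
have split C : #|C :&: P| = #|C :&: (P :&: Q)| + #|C :&: (P :\: Q)|.
  by rewrite setIA -(cardsID Q (C :&: P)) setIDA.
have /minP : good (P :\: Q).
  apply/and3P; split.
  - by apply/forallP => y; rewrite !inE Pa Qa.
  - by apply/forallP => y; rewrite !inE Pb Qb.
  - by move: ltP; rewrite !split; lia.
move=> /(_ (subsetDl _ _)) /setP/(_ x).
by rewrite !inE xQ xP.
Qed.
End Kempe.

(** * Edge-colourings as families of involutions, and extension by one vertex *)

Section Vizing.
Variables T I : finType.
Implicit Types (s : I -> T -> T) (K : {set I}) (N : {set T}) (X : I -> {set T}).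

(* [s i] exchanges the ends of every edge of colour [i] and fixes the vertices
   missed by colour [i]. *)
Definition edge_colouring s :=
  (forall i, involutive (s i)) /\
  (forall i j x, s i x = s j x -> s i x != x -> i = j).

Definition joined s x y := [exists i, s i x == y].

(** A Kempe exchange when [P] is a union of components of the colours [i] and [j], that is,
    preserved by [s i] and [s j]. *)
Definition kempe_swap s i j (P : {set T}) l x :=
  if x \in P then s (tperm i j l) x else s l x.

Lemma kempe_swap_colouring s i j P : edge_colouring s ->
    preserves (s i) P -> preserves (s j) P ->
  edge_colouring (kempe_swap s i j P) /\
  joined (kempe_swap s i j P) =2 joined s.
Proof.
move=> [sI sD] Pi Pj; split; first split.
- move=> l x; rewrite /kempe_swap; case: tpermP => [->|->|_ _].
  + by case xP: (x \in P); rewrite ?Pi ?Pj xP sI.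
  + by case xP: (x \in P); rewrite ?Pi ?Pj xP sI.
  + by rewrite !if_same sI.
- move=> l m x; rewrite /kempe_swap; case: (x \in P); last exact: sD.
  by move=> e /(sD _ _ _ e) /perm_inj.
- move=> x y; rewrite /joined /kempe_swap; apply/existsP/existsP => -[l].
    by case: (x \in P) => h; [exists (tperm i j l) | exists l].
  by case: (x \in P) => h; [exists (tperm i j l); rewrite tpermK | exists l].
Qed.

Lemma sum_two (F : I -> nat) K i j : i \in K -> j \in K -> i != j ->
  \sum_(l in K) F l = F i + F j + \sum_(l in K | (l != i) && (l != j)) F l.
Proof.
move=> iK jK ij; rewrite (bigD1 i) //= (bigD1 j) /=; last by rewrite jK eq_sym.
by rewrite addnA; congr (_ + _); apply: eq_bigl => l; rewrite andbA.
Qed.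

(* Each neighbour is in two of the sets [X l], except [u0] which is in one, so
   the sizes sum to the odd number [2 * #|N| - 1], which is less than [2 * #|K|].
   When the sum of their squares is minimal this forces some [X i] to be a
   singleton. *)
Lemma balance K N (u0 v : T) : u0 \in N -> #|N| <= #|K| -> forall n s X,
    \sum_(l in K) #|X l| ^ 2 = n -> edge_colouring s ->
    (forall l, l \in K -> s l v = v) ->
    (forall l, l \in K -> X l \subset N) ->
    (forall l u, l \in K -> u \in X l -> s l u = u) ->
    (forall u, u \in N -> #|[set l in K | u \in X l]| = 2 - (u == u0)) ->
  exists s' X', [/\ edge_colouring s', joined s' =2 joined s,
    (forall l, l \in K -> s' l v = v) &
    [/\ (forall l, l \in K -> X' l \subset N),
      (forall l u, l \in K -> u \in X' l -> s' l u = u),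
      (forall u, u \in N -> #|[set l in K | u \in X' l]| = 2 - (u == u0)) &
      exists2 i, i \in K & #|X' i| = 1]].
Proof.
move=> u0N NK n; have [m] := ubnP n; elim: m n => // m IH n nm s X Phi sC sv XN Xs Xc.
case: (pickP [pred i in K | #|X i| == 1]) => [i /andP[iK /eqP i1]|no1].
  by exists s, X; split => //; split => //; exists i.
have {no1} X1 i : i \in K -> #|X i| != 1.
  by move=> iK; have := no1 i; rewrite /= iK /= => ->.
have sumX : \sum_(l in K) #|X l| = (2 * #|N|).-1.
  transitivity (\sum_(l in K) \sum_(u in N) (u \in X l)).
    apply: eq_bigr => l lK; rewrite -sum1_card [RHS](big_setID (X l)) /=.
    rewrite [X in _ = _ + X]big1 ?addn0; last by move=> u /setDP[_ /negPf->].
    rewrite (setIidPr (XN _ lK)); apply: eq_bigr => u -> //.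
  rewrite exchange_big /=.
  transitivity (\sum_(u in N) (2 - (u == u0))).
    apply: eq_bigr => u uN; rewrite -Xc // -sum1_card.
    rewrite [RHS](eq_bigl (fun l => (l \in K) && (u \in X l))); last by move=> l; rewrite inE.
    by rewrite big_mkcondr /=; apply: eq_bigr => l _; case: (u \in X l).
  rewrite (bigD1 u0) //= eqxx (eq_bigr (fun=> 2)); last by move=> u /andP[_ /negPf->].
  rewrite sum_nat_const (cardsD1 u0 N) u0N.
  rewrite (_ : #|[pred u in N | u != u0]| = #|N :\ u0|); last first.
    by apply: eq_card => u; rewrite !inE andbC.
  lia.
have N0 : 0 < #|N| by rewrite (cardsD1 u0) u0N.
(* Otherwise all sizes are at least 2, as none is 1, and the sum reaches [2 * #|K|]. *)
have [j jK Xj] : exists2 j, j \in K & #|X j| = 0.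
  case: (pickP [pred j in K | #|X j| == 0]) => [j /andP[jK /eqP]|no0]; first by exists j.
  suff : \sum_(l in K) 2 <= \sum_(l in K) #|X l| by rewrite sumX sum_nat_const; lia.
  apply: leq_sum => l lK; have := X1 l lK; have := no0 l; rewrite /= lK /=; lia.
(* Otherwise all sizes are 0 or 2, and the sum is even. *)
have [i iK Xi] : exists2 i, i \in K & 3 <= #|X i|.
  case: (pickP [pred i in K | 3 <= #|X i|]) => [i /andP[iK]|no3]; first by exists i.
  suff : ~~ odd (\sum_(l in K) #|X l|) by rewrite sumX; lia.
  apply: (big_ind (fun n => ~~ odd n)) => // [p q|l lK].
    by rewrite oddD => /negPf-> /negPf->.
  have := X1 l lK; have := no3 l; rewrite /= lK /=; lia.
have ij : i != j by apply: contraTneq Xi => ->; rewrite Xj.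
have [sI sD] := sC.
(* As [X j] is empty, [P] contains one or two points of [X i], hence not all of them; the exchange
   on [P] moves these to colour [j]. *)
have [|P [Pi Pj /andP[lt le2]]] := @kempe_excess _ (s i) (s j) (X i) (X j)
  (sI i) (sI j) (Xs i ^~ iK) (Xs j ^~ jK); first by rewrite Xj; lia.
have [sC' sJ'] := kempe_swap_colouring sC Pi Pj.
have tK l : (tperm i j l \in K) = (l \in K).
  by case: tpermP => [->|->|//]; rewrite iK jK.
pose X' l := [set x | if x \in P then x \in X (tperm i j l) else x \in X l].
have X'i : #|X' i| + #|X i :&: P| = #|X i|.
  have -> : X' i = X i :\: P.
    apply/setP => x; rewrite !inE tpermL; case: (x \in P) => //=.
    by rewrite (cards0_eq Xj) inE.
  by rewrite addnC cardsID.
have X'j : #|X' j| = #|X i :&: P|.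
  apply: eq_card => x; rewrite !inE tpermR; case: (x \in P); rewrite ?andbT //.
  by rewrite (cards0_eq Xj) inE andbF.
have [|||||s' [X'' [h1 h2 h3 h4]]] :=
  IH (\sum_(l in K) #|X' l| ^ 2) _ (kempe_swap s i j P) X' erefl sC'.
(* Moving [c] points out of [d], with [0 < c < d], lowers the squares: [(d - c)^2 + c^2 < d^2]. *)
- apply: (@leq_trans n); last by rewrite -ltnS.
  rewrite -Phi !(sum_two _ iK jK ij) (eq_bigr (fun l => #|X l| ^ 2)); last first.
    move=> l /and3P[_ li lj]; congr (_ ^ 2); apply: eq_card => x.
    by rewrite inE tpermD 1?eq_sym // if_same.
  rewrite ltn_add2r Xj; move: lt; rewrite (cards0_eq Xj) set0I cards0.
  nia.
- by move=> l lK; rewrite /kempe_swap; case: ifP => _; apply: sv; rewrite ?tK.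
- move=> l lK; apply/subsetP => x; rewrite inE; case: ifP => _;
    by apply/subsetP/XN; rewrite ?tK.
- move=> l u lK; rewrite inE /kempe_swap; case: ifP => _; by apply: Xs; rewrite ?tK.
- move=> u uN; rewrite -Xc //; case uP: (u \in P); last first.
    by apply: eq_card => l; rewrite !inE uP.
  rewrite -[RHS](card_preimset _ (@perm_inj _ (tperm i j))).
  by apply: eq_card => l; rewrite !inE uP tK.
exists s', X''; split => // x y; by rewrite h2 sJ'.
Qed.

Lemma subset_of_card (U : finType) (A : {set U}) k : k <= #|A| ->
  exists2 B : {set U}, B \subset A & #|B| = k.
Proof.
move=> kA; exists [set x in take k (enum A)].
  by apply/subsetP => x; rewrite inE => /mem_take; rewrite mem_enum.
rewrite cardsE (card_uniqP _) ?take_uniq ?enum_uniq // size_takel //.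
by rewrite -cardE.
Qed.

(** [N] holds the neighbours of [v] still to be joined, [K] the colours still available. After
    [balance], each vertex of [N] has selected missed colours, and some colour [i] is selected by a
    single [u]. Giving [i] to [uv], then dropping [i] and [u], costs the other vertices no selected
    colour. *)
Lemma colouring_add_vertex (v : T) n : forall K N s u0, #|N| = n -> n <= #|K| ->
    edge_colouring s -> v \notin N ->
    (forall i, i \in K -> s i v = v) ->
    (forall u, u \in N -> ~~ joined s v u) ->
    (forall u, u \in N -> 2 - (u == u0) <= #|[set i in K | s i u == u]|) ->
  exists2 s', edge_colouring s' & forall x y, x != y ->
    joined s' x y = [|| joined s x y, (x == v) && (y \in N) | (y == v) && (x \in N)].
Proof.
elim: n => [|n IH] K N s u0 Nn nK sC vN sv nJ miss.
  exists s => // x y _; have /setP N0 := cards0_eq Nn.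
  by rewrite !N0 !inE !andbF !orbF.
(* If [u0] is outside [N], all of [N] miss two colours and any of them can serve as [u0]. *)
wlog u0N : u0 miss / u0 \in N => [thm|].
  have [u uN] : exists u, u \in N by apply/set0Pn; rewrite -card_gt0 Nn.
  have [u0N|u0N] := boolP (u0 \in N); first exact: (thm u0).
  apply: (thm u _ uN) => w wN; have := miss w wN.
  have -> : w == u0 = false by apply: contraNF u0N => /eqP <-.
  by apply: leq_trans; rewrite leq_subr.
(* [balance] requires exact counts, so surplus missed colours are left out. *)
have [M MP] : exists M : T -> {set I}, forall u, u \in N ->
    M u \subset [set i in K | s i u == u] /\ #|M u| = 2 - (u == u0).
  apply: (@fin_all_exists _ (fun=> {set I}) (fun u B => u \in N ->
    B \subset [set i in K | s i u == u] /\ #|B| = 2 - (u == u0))) => u.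
  case: (boolP (u \in N)) => [uN|_]; last by exists set0.
  by have [B] := subset_of_card (miss u uN); exists B.
pose X i := [set u in N | i \in M u].
have [||||s1 [X1 [s1C s1J s1v [X1N X1s X1c [i iK]]]]] :=
    @balance K N u0 v u0N _ _ s X erefl sC sv; first by rewrite Nn.
- by move=> l lK; apply/subsetP => u; rewrite inE => /andP[].
- move=> l u lK; rewrite inE => /andP[uN lM].
  by have [/subsetP/(_ l lM)] := MP u uN; rewrite inE => /andP[_ /eqP].
- move=> u uN; have [/subsetP sub <-] := MP u uN; apply: eq_card => l.
  rewrite !inE uN /=; case lM: (l \in M u); rewrite ?andbF //.
  by have := sub l lM; rewrite inE => /andP[->].
move=> /eqP/cards1P[u X1i].
have uX : u \in X1 i by rewrite X1i inE.
have uN : u \in N by apply: (subsetP (X1N i iK)).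
have s1u : s1 i u = u by exact: X1s.
have s1vi : s1 i v = v by exact: s1v.
have uv : u != v by apply: contraNneq vN => <-.
have nJ1 : ~~ joined s1 v u by rewrite s1J nJ.
have [sI sD] := s1C.
(* [s1 i] fixes both [u] and [v], so composing it with their transposition adds the edge [uv] to
   colour [i]. *)
pose s2 l x := if l == i then tperm u v (s1 l x) else s1 l x.
have s2E l x : x != u -> x != v -> s2 l x = s1 l x.
  move=> xu xv; rewrite /s2; case: eqP => // ->; rewrite tpermD // eq_sym.
    by apply: contraNneq xu => e; rewrite -s1u -e sI.
  by apply: contraNneq xv => e; rewrite -s1vi -e sI.
have s2u l : s2 l u = if l == i then v else s1 l u.
  by rewrite /s2; case: eqP => // ->; rewrite s1u tpermL.
have s2v l : s2 l v = if l == i then u else s1 l v.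
  by rewrite /s2; case: eqP => // ->; rewrite s1vi tpermR.
have nvu l : s1 l v != u by move: nJ1; rewrite negb_exists => /forallP/(_ l).
have nuv l : s1 l u != v by apply: contraNneq (nvu l) => <-; rewrite sI.
have s2C : edge_colouring s2.
  split=> [l x|l m x].
    have [->|xu] := eqVneq x u.
      rewrite s2u; case: (eqVneq l i) => [->|li]; first by rewrite s2v eqxx.
      by rewrite /s2 (negPf li) sI.
    have [->|xv] := eqVneq x v.
      rewrite s2v; case: (eqVneq l i) => [->|li]; first by rewrite s2u eqxx.
      by rewrite /s2 (negPf li) sI.
    rewrite [s2 l x]s2E // /s2 sI; case: ifP => // _.
    by rewrite tpermD // eq_sym.
  have [->|xu] := eqVneq x u.
    rewrite !s2u; case: (eqVneq l i) => [->|_]; case: (eqVneq m i) => [->|_] //.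
    - by move/eqP; rewrite eq_sym (negPf (nuv _)).
    - by move/eqP; rewrite (negPf (nuv _)).
    - exact: sD.
  have [->|xv] := eqVneq x v.
    rewrite !s2v; case: (eqVneq l i) => [->|_]; case: (eqVneq m i) => [->|_] //.
    - by move/eqP; rewrite eq_sym (negPf (nvu _)).
    - by move/eqP; rewrite (negPf (nvu _)).
    - exact: sD.
  by rewrite !s2E //; exact: sD.
have s2J x y : x != y -> joined s2 x y =
    [|| joined s x y, (x == v) && (y == u) | (y == v) && (x == u)].
  move=> xy; rewrite -s1J; have [xu|xu] := eqVneq x u.
    rewrite xu (negPf uv) /= andbT; have [->|yv] /= := eqVneq y v.
      by rewrite orbT; apply/existsP; exists i; rewrite s2u eqxx.
    rewrite orbF; apply: eq_existsb => l; rewrite s2u; case: (eqVneq l i) => // ->.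
    by rewrite s1u -xu (negPf xy) eq_sym (negPf yv).
  rewrite andbF orbF; have [xv|xv] := eqVneq x v.
    rewrite xv /=; have [->|yu] /= := eqVneq y u.
      by rewrite orbT; apply/existsP; exists i; rewrite s2v eqxx.
    rewrite orbF; apply: eq_existsb => l; rewrite s2v; case: (eqVneq l i) => // ->.
    by rewrite s1vi -xv (negPf xy) eq_sym (negPf yu).
  by rewrite orbF; apply: eq_existsb => l; rewrite s2E.
have vN' : v \notin N :\ u by rewrite inE (negPf vN) andbF.
have [|||||s3 s3C s3J] := IH (K :\ i) (N :\ u) s2 u0 _ _ s2C vN'.
- by have := cardsD1 u N; rewrite uN Nn => -[].
- by move: nK; rewrite (cardsD1 i K) iK.
- by move=> l; rewrite !inE => /andP[li lK]; rewrite s2v (negPf li) s1v.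
- move=> w; rewrite !inE => /andP[wu wN].
  have vw : v != w by apply: contraNneq vN => ->.
  by rewrite s2J // (negPf (nJ w wN)) eqxx (negPf wu) /= eq_sym (negPf vw).
(* As [X1 i] contains only [u], no colour selected for [w] is [i]. *)
- move=> w; rewrite !inE => /andP[wu wN]; rewrite -X1c //.
  apply: subset_leq_card; apply/subsetP => l; rewrite !inE => /andP[lK wX].
  have vw : w != v by apply: contraNneq vN => <-.
  rewrite lK s2E // X1s // eqxx !andbT.
  by apply: contraTneq wX => ->; rewrite X1i inE.
exists s3 => // x y xy; rewrite s3J // s2J // !inE.
have uNE z : (z == u) ==> (z \in N) by apply/implyP => /eqP ->.
move: (uNE x) (uNE y); case: (joined s x y) => //=.
by case: (x == v); case: (y == v); case: (x == u); case: (y == u);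
  case: (x \in N); case: (y \in N).
Qed.
End Vizing.

(** Induction on the set [A] of vertices whose mutual edges are coloured. While the edge to [v] is
    uncoloured, a neighbour of [v] has at most [max_degree G - 1] coloured edges and misses two
    colours. *)
Theorem vizing (G : sgraph) :
  exists2 s : 'I_(max_degree G).+1 -> G -> G,
    edge_colouring s & forall x y, x != y -> joined s x y = adj x y.
Proof.
suff part n : forall A : {set G}, #|A| = n ->
    exists2 s : 'I_(max_degree G).+1 -> G -> G, edge_colouring s &
      forall x y, x != y -> joined s x y = [&& adj x y, x \in A & y \in A].
  have [s sC sJ] := part _ setT erefl; exists s => // x y xy.
  by rewrite sJ // !inE !andbT.
elim: n => [|n IH] A cA.
  exists (fun=> id) => [|x y xy]; first by split=> // i j x _; rewrite eqxx.
  rewrite (cards0_eq cA) !inE !andbF; apply/negbTE/existsP => -[_].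
  by rewrite (negPf xy).
have [v vA] : exists v, v \in A by apply/set0Pn; rewrite -card_gt0 cA.
have [|s sC sJ] := IH (A :\ v); first by have := cardsD1 v A; rewrite vA cA => -[].
pose N := [set u in A :\ v | adj v u].
have degD (u : G) : #|[set y | adj u y]| <= max_degree G.
  exact: (leq_bigmax (F := fun x : G => #|[set y | adj x y]|)).
have vN : v \notin N by rewrite !inE eqxx.
have sv i : s i v = v.
  apply/eqP/negPn/negP => ne; have : joined s v (s i v) by apply/existsP; exists i.
  by rewrite sJ 1?eq_sym // !inE eqxx andbF.
(* The exceptional vertex [u0] is taken to be [v], outside [N], since every neighbour misses two
   colours. *)
have [|||s' sC' sJ'] :=
  @colouring_add_vertex _ _ v #|N| setT N s v erefl _ sC vN (fun i _ => sv i).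
- rewrite cardsT card_ord; apply: leq_trans (leqW (degD v)).
  by apply: subset_leq_card; apply/subsetP => u; rewrite !inE => /andP[].
- move=> u uN; have uv : v != u by apply: contraNneq vN => ->.
  by rewrite sJ // !inE eqxx andbF.
- move=> u uN; apply: leq_trans (leq_subr _ _) _.
  have uv : v != u by apply: contraNneq vN => ->.
  have vu : adj u v by move: uN; rewrite !inE adj_sym => /andP[].
  have -> : [set i in setT | s i u == u] = [set i | s i u == u].
    by apply/setP => i; rewrite !inE.
  have sub : (s^~ u) @: (~: [set i | s i u == u]) \subset [set y | adj u y] :\ v.
    apply/subsetP => _ /imsetP[i + ->]; rewrite !inE => ne.
    have : joined s u (s i u) by apply/existsP; exists i.
    have ne' : u != s i u by rewrite eq_sym.
    by rewrite sJ // => /and3P[-> _ /setD1P[-> _]].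
  have := subset_leq_card sub; rewrite card_in_imset; last first.
    by move=> i j; rewrite !inE => ne _ /sC.2; apply.
  have := cardsD1 v [set y | adj u y]; have := degD u.
  have := cardsC [set i | s i u == u]; rewrite card_ord inE vu.
  lia.
exists s' => // x y xy; rewrite sJ' // sJ // !inE.
have [xv|xv] := eqVneq x v; have [yv|yv] := eqVneq y v; rewrite ?andbT ?andbF ?orbF //=.
- by rewrite xv yv eqxx in xy.
- by rewrite xv vA /= andbC.
- by rewrite yv vA /= andbT andbC adj_sym.
Qed.

(** * The upper bound *)

Section Contracting.
Variable C : graph_class.
Hypothesis C_contraction : contraction_closed C.

(** The involution [m] encodes a matching, unmatched vertices being fixed. Its edges are contracted
    one at a time: [A] collects the ends already treated, and [f] identifies exactly the matched
    pairs within [A], so the next edge still has distinct, adjacent images. *)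
Lemma contract_matching (G : sgraph) (m : G -> G) : C G -> involutive m ->
    (forall x, m x != x -> adj x (m x)) ->
  exists (H : sgraph) (f : G -> H), [/\ C H,
    forall x y, (f x == f y) = (x == y) || (y == m x) &
    forall x y, adj x y -> f x != f y -> adj (f x) (f y)].
Proof.
move=> CG mI madj.
suff part n : forall (A : {set G}) (H : sgraph) (f : G -> H), #|~: A| < n ->
    (forall x, (m x \in A) = (x \in A)) -> C H ->
    (forall x y, (f x == f y) = (x == y) || (x \in A) && (y == m x)) ->
    (forall x y, adj x y -> f x != f y -> adj (f x) (f y)) ->
  exists (H : sgraph) (f : G -> H), [/\ C H,
    forall x y, (f x == f y) = (x == y) || (y == m x) &
    forall x y, adj x y -> f x != f y -> adj (f x) (f y)].
  by apply: (part _ set0 G id (ltnSn _)) => // [x|x y]; rewrite !inE // orbF.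
elim: n => // n IH A H f cA Am CH fE fadj.
case: (pickP [pred x | (x \notin A) && (m x != x)]) => [x /andP[xA mx]|full]; last first.
  exists H, f; split=> // x y; rewrite fE; case: (boolP (x \in A)) => //= xA.
  have := full x; rewrite /= xA /= => /negbFE/eqP ->.
  by rewrite orbF eq_sym orbb.
have xy : adj (f x) (f (m x)).
  by apply: fadj; [exact: madj | rewrite fE (negPf xA) orbF eq_sym].
pose g := contract_map xy \o f.
have gE a : val (g a) = if f a == f (m x) then f x else f a.
  by rewrite /= val_insubd; case: eqP.
have fx a : (f a == f x) = (a == x).
  by rewrite eq_sym fE (negPf xA) orbF eq_sym.
have fmx a : (f a == f (m x)) = (a == m x).
  by rewrite eq_sym fE Am (negPf xA) orbF eq_sym.
apply: (IH (x |: (m x |: A)) (contract_edge xy) g) => //.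
- rewrite ltnS in cA; apply: leq_trans cA; apply: proper_card; apply/properP; split.
    by apply/subsetP => a; rewrite !inE; do 2 case: eqP => //=.
  by exists x; rewrite !inE ?eqxx.
- by move=> a; rewrite !inE Am (inv_eq mI) (inj_eq (inv_inj mI)) orbCA.
- exact: C_contraction.
- move=> a b; rewrite -val_eqE !gE !fmx !inE.
  case: (eqVneq a (m x)) => [->|am]; case: (eqVneq b (m x)) => [->|bm]; rewrite ?eqxx //=.
  + by rewrite eq_sym fx mI orbT.
  + rewrite fx (negPf am) (inj_eq (inv_inj mI)) (eq_sym x).
    by case: (eqVneq a x); rewrite ?andbF.
  + by rewrite fE; case: (eqVneq a x) => [->|_] //=; rewrite (negPf bm) !andbF.
- move=> a b ab gab; rewrite /= /contract_adj gab; apply/existsP; exists (f a).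
  apply/existsP; exists (f b); rewrite !eqxx !andbT; apply: fadj => //.
  by apply: contraNneq gab => fab; rewrite /g /= fab.
Qed.
End Contracting.

Lemma colourable_leq (G : sgraph) k l : k <= l -> colourable G k -> colourable G l.
Proof.
move=> kl /existsP[f /forallP fP]; apply/existsP.
exists [ffun x => widen_ord kl (f x)]; apply/forallP => x; apply/forallP => y.
rewrite !ffunE; exact: (forallP (fP x) y).
Qed.

Lemma strong_chromatic_index_le (G : sgraph) (K : finType) (F : K -> {set {set G}}) :
    (forall p, induced_matching (F p)) ->
    (forall e, e \in edges G -> exists p, e \in F p) ->
    (forall p q e, e \in F p -> e \in F q -> p = q) ->
  strong_chromatic_index G <= #|K|.
Proof.
(* Empty classes are dropped, as a partition has no empty block. *)
move=> Fi Fc Fd; pose P := [set F p | p : K] :\ set0.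
rewrite /strong_chromatic_index; case: ex_minnP => k _ kmin.
apply: (@leq_trans #|P|); last first.
  by apply: leq_trans (leq_imset_card F _); rewrite subset_leq_card ?subsetDl.
apply: kmin; apply/existsP; exists P; rewrite eqxx andbT; apply/andP; split.
  apply/and3P; split; last by rewrite !inE eqxx.
  - apply/eqP/setP => e; apply/bigcupP/idP => [[M]|/Fc[p ep]].
      rewrite inE => /andP[_ /imsetP[p _ ->]]; apply/subsetP.
      by case/and3P: (Fi p).
    exists (F p) => //; rewrite inE imset_f // andbT inE.
    by apply/set0Pn; exists e.
  - apply/trivIsetP => _ _ /setD1P[_ /imsetP[p _ ->]] /setD1P[_ /imsetP[q _ ->]] npq.
    rewrite -setI_eq0; apply: contraNT npq => /set0Pn[e]; rewrite inE => /andP[ep eq].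
    by rewrite (Fd _ _ _ ep eq).
by apply/forallP => M; apply/implyP => /setD1P[_ /imsetP[p _ ->]].
Qed.

Lemma strong_chromatic_index_upper (C : graph_class) (G : sgraph) k :
    contraction_closed C -> C G -> (forall H, C H -> chromatic_number H <= k) ->
  strong_chromatic_index G <= (max_degree G).+1 * k.
Proof.
move=> C_contraction CG Ck; have [s [sI sD] sJ] := vizing G.
have sadj i x : s i x != x -> adj x (s i x).
  by move=> ne; rewrite -sJ 1?eq_sym //; apply/existsP; exists i.
(* [c i] is pulled back from a proper colouring of the graph with the matching of colour [i]
   contracted. *)
have [c cP] : exists c : 'I_(max_degree G).+1 -> {ffun G -> 'I_k}, forall i,
    (forall x, c i (s i x) = c i x) /\
    (forall x y, adj x y -> y != s i x -> c i x != c i y).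
  apply: (@fin_all_exists _ (fun=> {ffun G -> 'I_k}) (fun i ci =>
    (forall x, ci (s i x) = ci x) /\
    (forall x y, adj x y -> y != s i x -> ci x != ci y))) => i.
  have [H [f [CH fE fadj]]] := contract_matching C_contraction CG (sI i) (sadj i).
  have /existsP[h /forallP hP] : colourable H k.
    by apply: colourable_leq (Ck H CH) _; rewrite /chromatic_number; case: ex_minnP.
  exists [ffun x => h (f x)]; split=> [x|x y xy yx].
    by rewrite !ffunE; congr (h _); apply/esym/eqP; rewrite fE eqxx orbT.
  rewrite !ffunE; apply: (implyP (forallP (hP _) _)); apply: fadj => //.
  by rewrite fE (negPf yx) orbF (contract_neq xy).
pose F (p : 'I_(max_degree G).+1 * 'I_k) := [set e in edges G |
  [exists x, [&& s p.1 x != x, c p.1 x == p.2 & e == [set x; s p.1 x]]]].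
have FE p e z : e \in F p -> z \in e ->
    [/\ e = [set z; s p.1 z], s p.1 z != z & c p.1 z = p.2].
  rewrite inE => /andP[_ /existsP[x /and3P[sx /eqP cx /eqP ->]]].
  rewrite !inE => /orP[] /eqP -> //; rewrite sI setUC eq_sym.
  by split=> //; rewrite (cP p.1).1.
rewrite -[k in _ * k]card_ord -[X in X * _]card_ord -card_prod.
apply: (@strong_chromatic_index_le _ _ F).
- move=> p; apply/and3P; split.
  + by apply/subsetP => e; rewrite inE => /andP[].
  + apply/trivIsetP => e f ep fp; rewrite -setI_eq0; apply: contraNT => /set0Pn[z].
    by rewrite inE => /andP[/(FE _ _ _ ep)[-> _ _] /(FE _ _ _ fp)[-> _ _]].
  (* Both ends of [e] have value [p.2] under [c p.1], and adjacent vertices share a value only along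
     an edge of colour [p.1]. *)
  + apply/forallP => e; apply/implyP => eE; apply/implyP => sub.
    have := eE; rewrite inE => /existsP[x /existsP[y /andP[xy /eqP exy]]].
    have cov z : z \in e -> s p.1 z != z /\ c p.1 z = p.2.
      by move=> /(subsetP sub)/bigcupP[f fp /(FE _ _ _ fp)[]].
    have [sx cx] : s p.1 x != x /\ c p.1 x = p.2 by apply: cov; rewrite exy !inE eqxx.
    have [_ cy] : s p.1 y != y /\ c p.1 y = p.2 by apply: cov; rewrite exy !inE eqxx orbT.
    rewrite inE eE; apply/existsP; exists x; rewrite sx cx eqxx exy /=.
    have [-> //|ne] := eqVneq y (s p.1 x).
    by have := (cP p.1).2 _ _ xy ne; rewrite cx cy eqxx.
- move=> e eE; have := eE; rewrite inE => /existsP[x /existsP[y /andP[xy /eqP exy]]].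
  have := xy; rewrite -sJ ?(contract_neq xy) // => /existsP[i /eqP six].
  exists (i, c i x); rewrite inE eE; apply/existsP; exists x => /=.
  by rewrite six exy !eqxx eq_sym (contract_neq xy).
- move=> [i a] [j b] e ep eq.
  have := ep; rewrite inE => /andP[_ /existsP[x /and3P[_ _ /eqP ex]]].
  have xe : x \in e by rewrite ex !inE eqxx.
  have [e1 /= n1 c1] := FE _ _ _ ep xe; have [e2 /= n2 c2] := FE _ _ _ eq xe.
  have ij : i = j.
    apply: (sD _ _ x) => //; have : s i x \in e by rewrite e1 !inE eqxx orbT.
    by rewrite e2 !inE (negPf n1) => /eqP.
  by rewrite -c1 -c2 ij.
Qed.

(** * The lower bound *)

(* [i] embeds [G] as an induced subgraph of [H]; the other vertices of [H] are
   leaves, [h] being attached to [i (p h)], and [x] receives [t] of them. *)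
Definition pendant_extension (G H : sgraph) (i : G -> H) (p : H -> G) (t : G -> nat) :=
  [/\ injective i,
    forall x y, adj (i x) (i y) = adj x y,
    forall h y, h \notin codom i -> adj h y = (y == i (p h)) &
    forall x, #|[set h | (h \notin codom i) && (p h == x)]%SET| = t x].

(** One pendant edge is attached per entry of [s], so a repeated vertex gets several leaves. *)
Lemma pendant_extension_exists (C : graph_class) (G : sgraph) (s : seq G) :
    pendant_closed C -> C G ->
  exists (H : sgraph) (i : G -> H) (p : H -> G),
    C H /\ pendant_extension i p (fun x => count_mem x s).
Proof.
move=> C_pendant CG; elim: s => [|x s [H [i [p [CH [iinj iadj hadj hcount]]]]]].
  exists G, id, id; split=> //; split=> // [h y|x].
    by rewrite codom_f.
  by apply: eq_card0 => h; rewrite inE codom_f.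
have codomS h : (Some h \in codom (Some \o i)) = (h \in codom i).
  apply/codomP/codomP => -[y]; first by case=> ->; exists y.
  by move=> ->; exists y.
have codomN : None \notin codom (Some \o i : G -> attach_pendant (i x)).
  by apply/codomP => -[].
exists (attach_pendant (i x)), (Some \o i), (fun o => if o is Some h then p h else x).
split; first exact: C_pendant.
split=> [y z [/iinj] //|y z|[h|] [z|] //=|y].
- exact: iadj.
- by rewrite codomS => /hadj ->.
- by rewrite codomS => hi; apply: contraNF hi => /eqP ->; rewrite codom_f.
- rewrite (cardsD1 None) inE codomN /= -hcount; congr (_ + _).
  rewrite -[RHS](card_imset _ Some_inj); apply: eq_card => -[h|].
    by rewrite !inE mem_imset ?inE ?codomS //; exact: Some_inj.
  by rewrite !inE; apply/esym/negbTE/imsetP => -[].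
Qed.

(** Vertices of [G] gain [t], and leaves have degree 1, at most [t]. For empty [G], [H] would be
    empty too, of maximum degree 0 instead of [t]. *)
Lemma max_degree_pendant_extension (G H : sgraph) (i : G -> H) (p : H -> G) t :
  0 < #|G| -> 0 < t -> pendant_extension i p (fun=> t) -> max_degree H = max_degree G + t.
Proof.
move=> G0 t0 [iinj iadj hadj hcount].
have degi x : #|[set h | adj (i x) h]%SET| = #|[set y | adj x y]%SET| + t.
  rewrite -(hcount x) -(card_imset _ iinj) -cardsUI.
  rewrite [X in _ = _ + X](_ : _ = 0); last first.
    apply: eq_card0 => h; rewrite !inE; apply/negP => /andP[/imsetP[y _ ->]].
    by rewrite codom_f.
  rewrite addn0; apply: eq_card => h; rewrite !inE; have [|hi] := boolP (h \in codom i).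
    case/codomP => y ->; rewrite iadj orbF; apply/idP/imsetP => [xy|[z + /iinj ->]].
      by exists y; rewrite ?inE.
    by rewrite inE.
  rewrite adj_sym hadj // (inj_eq iinj) eq_sym; case: imsetP => // -[y _ e].
  by rewrite e codom_f in hi.
apply/eqP; rewrite eqn_leq; apply/andP; split.
  apply/bigmax_leqP => h _; have [/codomP[x ->]|hi] := boolP (h \in codom i).
    rewrite degi leq_add2r.
    exact: (leq_bigmax (F := fun x : G => #|[set y | adj x y]%SET|)).
  rewrite (_ : [set _ | _]%SET = [set i (p h)]%SET); last first.
    by apply/setP => y; rewrite !inE hadj.
  by rewrite cards1; lia.
have [x _ e] := @eq_bigmax_cond G predT (fun x : G => #|[set y | adj x y]%SET|) G0.
rewrite /max_degree [X in X + t <= _]e -degi.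
exact: (leq_bigmax (F := fun x : H => #|[set y | adj x y]%SET|)).
Qed.

Lemma fractional_chromatic_number_le (R : realType) (G H : sgraph)
    (i : G -> H) (p : H -> G) t :
    0 < t -> pendant_extension i p (fun=> t) ->
  (fractional_chromatic_number R G <= ((strong_chromatic_index H)%:R / t%:R)%:E)%E.
Proof.
move=> t0 [iinj iadj hadj hcount].
rewrite /strong_chromatic_index.
case: ex_minnP => k /existsP[P /andP[/andP[Ppart Pind] /eqP <-]] _.
have {}Pind M : M \in P -> induced_matching M.
  by move=> MP; apply: (implyP (forallP Pind M)).
have Pcover : finset.cover P = edges H by apply/eqP; case/and3P: Ppart.
have Ptriv : finset.trivIset P by case/and3P: Ppart.
have Medge M x e f : M \in P -> e \in M -> f \in M -> x \in e -> x \in f -> e = f.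
  move=> /Pind/and3P[_ /finset.trivIsetP trivM _] eM fM xe xf; apply/eqP.
  apply: contraTT xf => /(trivM _ _ eM fM); rewrite disjoint_subset => /subsetP/(_ x xe).
  by rewrite inE.
pose supp (M : {set {set H}}) := [set x | [exists h,
  [&& h \notin codom i, p h == x & [set h; i x]%SET \in M]]]%SET.
(* If adjacent [x] and [y] both had pendant edges in [M], inducedness would put the edge joining
   them in [M], where it meets the pendant edge at [i x]. *)
have supp_stable M : M \in P -> stable (supp M).
  move=> MP; apply/forallP => x; apply/implyP; rewrite inE.
  move=> /existsP[h /and3P[hi /eqP _ hM]].
  apply/forallP => y; apply/implyP; rewrite inE => /existsP[g /and3P[gi /eqP _ gM]].
  apply/negP => xy; have /and3P[_ _ /forallP/(_ [set i x; i y]%SET)] := Pind M MP.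
  have -> : [set i x; i y]%SET \in edges H.
    rewrite inE; apply/existsP; exists (i x); apply/existsP; exists (i y).
    by rewrite iadj xy eqxx.
  rewrite /= => /implyP/(_ _)/wrap[].
    apply/subsetP => z; rewrite !inE => /orP[] /eqP ->; apply/bigcupP.
      by exists [set h; i x]%SET => //; rewrite !inE eqxx orbT.
    by exists [set g; i y]%SET => //; rewrite !inE eqxx orbT.
  move=> eM; have /setP/(_ h) : [set h; i x]%SET = [set i x; i y]%SET.
    by apply: (Medge M (i x)) => //; rewrite !inE eqxx ?orbT.
  rewrite !inE eqxx /= => /esym/orP[] /eqP e; by rewrite e codom_f in hi.
(* The [t] pendant edges at [x] meet pairwise, so they lie in distinct classes. *)
have supp_card x : t <= #|[set M in P | x \in supp M]%SET|.
  pose leaves := [set h | (h \notin codom i) && (p h == x)]%SET.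
  have leafE h : h \in leaves -> [set h; i x]%SET \in edges H.
    rewrite !inE => /andP[hi /eqP ph]; apply/existsP; exists h; apply/existsP; exists (i x).
    by rewrite hadj // ph !eqxx.
  pose cl h := finset.pblock P [set h; i x]%SET.
  have clP h : h \in leaves -> cl h \in P.
    by move=> /leafE hE; apply: pblock_mem; rewrite Pcover.
  have clM h : h \in leaves -> [set h; i x]%SET \in cl h.
    by move=> /leafE hE; rewrite /cl mem_pblock Pcover.
  rewrite -(hcount x) -/leaves.
  have clinj : {in leaves &, injective cl}.
    move=> h g hl gl e; have /setP/(_ h) : [set h; i x]%SET = [set g; i x]%SET.
      apply: (Medge (cl h) (i x)); [exact: clP|exact: clM|by rewrite e clM|..];
        by rewrite !inE eqxx orbT.
    rewrite !inE eqxx /= => /esym/orP[] /eqP // e'.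
    by move: hl; rewrite inE e' codom_f.
  rewrite -(card_in_imset clinj); apply/subset_leq_card/subsetP => _ /imsetP[h hl ->].
  rewrite inE clP //= inE; apply/existsP; exists h; rewrite clM //.
  by move: hl; rewrite inE => /andP[-> ->].
(* Distinct classes may have the same support, so multiplicities are counted. *)
pose n S := #|[set M in P | supp M == S]%SET|.
have n_sum (Q : pred {set G}) : (\sum_(S : {set G} | stable S && Q S) n S =
    #|[set M in P | Q (supp M)]%SET|)%N.
  rewrite -[RHS]sum1_card (partition_big supp (fun S => stable S && Q S)) /=; last first.
    by move=> M; rewrite inE => /andP[MP ->]; rewrite supp_stable.
  apply: eq_bigr => S /andP[_ QS]; rewrite -[LHS]sum1_card; apply: eq_bigl => M.
  by rewrite !inE; case: eqP => [->|]; rewrite ?QS ?andbF ?andbT.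
pose w S : R := ((n S)%:R / t%:R)%R.
have tR : (0 < t%:R :> R)%R by rewrite ltr0n.
have w_sum (Q : pred {set G}) : (\sum_(S : {set G} | stable S && Q S) w S =
    #|[set M in P | Q (supp M)]%SET|%:R / t%:R)%R.
  by rewrite -mulr_suml -natr_sum n_sum.
apply: ereal_inf_lbound; exists w.
  split=> [S _|v]; first by rewrite divr_ge0 ?ler0n.
  rewrite w_sum ler_pdivlMr // mul1r ler_nat; exact: supp_card.
congr (_%:E); have := w_sum predT; under eq_bigl do rewrite andbT.
by move=> ->; congr (_%:R / _)%R; apply: eq_card => M; rewrite inE andbT.
Qed.

(** * The limit superior *)

Section Limsup.
Local Open Scope ring_scope.
Local Open Scope ereal_scope.
Variable R : realType.
Implicit Types (u : nat -> \bar R) (x y z : \bar R).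

Lemma limn_esup_le u y N : (forall n, (N <= n)%N -> u n <= y) -> limn_esup u <= y.
Proof.
move=> uy; apply: (le_trans
  (y := ereal_sup (classical_sets.image (fun n => (N <= n)%N) u))).
  apply: ereal_inf_lbound; exists (fun n => (N <= n)%N) => //; by exists N.
by apply: ge_ereal_sup => _ [n Nn <-]; exact: uy.
Qed.

Lemma limn_esup_ge u y :
  (forall z N, (forall n, (N <= n)%N -> u n <= z) -> y <= z) -> y <= limn_esup u.
Proof.
move=> yz; apply: le_ereal_inf_tmp => _ [V [N _ NV] <-]; apply: (yz _ N) => n Nn.
by apply: ereal_sup_ubound; exists n => //; exact: NV.
Qed.

(** Lets [n] tend to infinity; this absorbs the extra colour of Vizing's theorem in one bound, and
    the contribution of [max_degree G] in the other. *)
Lemma lee_addinvn x (a b : R) N : (0 <= b)%R ->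
  (forall n, (N < n)%N -> x <= (a + b / n%:R)%:E) -> x <= a%:E.
Proof.
move=> b0 xn; apply/lee_addgt0Pr => e e0.
pose n := (maxn N (Num.truncn (b / e))).+1.
apply: le_trans (xn n _) _; first by rewrite ltnS leq_maxl.
rewrite -EFinD lee_fin lerD2l ler_pdivrMr ?ltr0n // mulrC -ler_pdivrMr //.
apply: le_trans (ltW (truncnS_gt _)) _.
by rewrite ler_nat ltnS leq_maxr.
Qed.
End Limsup.

(** * The two inequalities for graph classes *)

Local Open Scope ereal_scope.

Lemma class_chi2_ge0 (R : realType) C D : 0 <= class_chi2 R C D.
Proof. by rewrite /class_chi2 /largest le_max lexx. Qed.

Lemma strong_chromatic_index_le_class (R : realType) (C : graph_class) (H : sgraph) :
  C H -> (strong_chromatic_index H)%:R%:E <= class_chi2 R C (max_degree H).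
Proof.
move=> CH; rewrite /class_chi2 /largest le_max; apply/orP; right.
by apply: ereal_sup_ubound; exists H.
Qed.

Lemma limn_esup_class_chi2_le (R : realType) (C : graph_class) : contraction_closed C ->
  limn_esup (fun D : nat => class_chi2 R C D / D%:R%:E) <= class_chi R C.
Proof.
move=> C_contraction.
have chi0 : 0 <= class_chi R C by rewrite /class_chi /largest le_max lexx.
case chiE : (class_chi R C) => [r||]; [|by rewrite leey|by rewrite chiE in chi0].
have r0 : (0 <= r)%R by rewrite chiE lee_fin in chi0.
(* Chromatic numbers are integers, so the bound [r] can be rounded down. *)
pose k := Num.truncn r.
have chik H : C H -> (chromatic_number H <= k)%N.
  move=> CH; rewrite truncn_ge_nat //.
  rewrite -lee_fin -chiE /class_chi /largest le_max; apply/orP; right.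
  by apply: ereal_sup_ubound; exists H.
apply: (le_trans (y := (k%:R)%:E)); last by rewrite lee_fin truncn_le.
(* [(D + 1) * k / D = k + k / D], at most [k + k / n] once [D >= n]. *)
apply: (@lee_addinvn _ _ _ k%:R 0) => // n n0; apply: (@limn_esup_le _ _ _ n) => D nD.
have D0 : (0 < D)%N by apply: leq_trans nD.
rewrite inver pnatr_eq0 (gtn_eqF D0).
apply: (le_trans (y := ((D.+1 * k)%:R)%:E * (D%:R^-1)%:E)).
  apply: lee_wpmul2r; first by rewrite lee_fin invr_ge0 ler0n.
  rewrite /class_chi2 /largest ge_max lee_fin ler0n /=.
  apply: ge_ereal_sup => _ [G [CG <-] ->]; rewrite lee_fin ler_nat.
  exact: strong_chromatic_index_upper CG chik.
rewrite -EFinM lee_fin mulSn natrD mulrDl natrM addrC.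
rewrite mulrAC divff ?mul1r ?pnatr_eq0 -?lt0n // lerD2l.
by rewrite ler_wpM2l ?ler0n // lef_pV2 ?posrE ?ltr0n // ler_nat.
Qed.

Lemma class_chi_f_le_limn_esup (R : realType) (C : graph_class) : pendant_closed C ->
  class_chi_f R C <= limn_esup (fun D : nat => class_chi2 R C D / D%:R%:E).
Proof.
move=> C_pendant.
(* This settles the 0 in [largest] and excludes [z = -oo]; evaluation at [N.+1] avoids dividing by
   0. *)
have ge0 z N : (forall n, (N <= n)%N -> class_chi2 R C n / n%:R%:E <= z) -> 0 <= z.
  move=> /(_ N.+1 (leqnSn N)); apply: le_trans.
  by rewrite inver pnatr_eq0 /= mule_ge0 ?class_chi2_ge0 // lee_fin invr_ge0 ler0n.
rewrite /class_chi_f /largest ge_max; apply/andP; split.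
  by apply: limn_esup_ge.
apply: ge_ereal_sup => _ [G CG ->]; apply: limn_esup_ge => z N uz.
have := ge0 _ _ uz; case: z uz => [z uz|_ _|//]; last by rewrite leey.
rewrite lee_fin => z0.
(* The empty graph, to which the degree formula does not apply, has a fractional colouring of weight
   0. *)
have [G0|G0] := posnP #|G|.
  apply: (le_trans (y := 0)); last by rewrite lee_fin.
  apply: ereal_inf_lbound; exists (fun=> 0%R); last by rewrite big1.
  by split=> // v; have := card0_eq G0 v; rewrite inE.
(* With [t] leaves per vertex the bound is [z * (max_degree G + t) / t], and [t > N] puts the
   maximum degree of [H] beyond [N]. *)
apply: (@lee_addinvn _ _ _ (z * (max_degree G)%:R) N).
  by rewrite mulr_ge0 ?ler0n.
move=> t Nt; have t0 : (0 < t)%N by apply: leq_ltn_trans Nt.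
have [H [i [p [CH ext]]]] :=
  pendant_extension_exists (flatten (nseq t (enum G))) C_pendant CG.
have {}ext : pendant_extension i p (fun=> t).
  have [e1 e2 e3 e4] := ext; split=> // x; rewrite e4 count_flatten map_nseq sumn_nseq.
  by rewrite count_uniq_mem ?enum_uniq // mem_enum mul1n.
apply: le_trans (fractional_chromatic_number_le _ t0 ext) _; rewrite lee_fin.
have degH := max_degree_pendant_extension G0 t0 ext.
have D0 : (0 < max_degree H)%N by rewrite degH; lia.
have := le_trans (lee_wpmul2r _ (strong_chromatic_index_le_class R CH))
  (uz (max_degree H) _).
rewrite inver pnatr_eq0 (gtn_eqF D0) -EFinM lee_fin invr_ge0 ler0n lee_fin.
move=> /(_ isT); rewrite ler_pdivrMr ?ltr0n // degH => h.
rewrite ler_pdivrMr ?ltr0n // mulrDl divfK ?pnatr_eq0 -?lt0n //.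
by rewrite -mulrDr -natrD addnC; apply: h; lia.
Qed.

Theorem theorem1p2 (R : realType) (C : graph_class)
    (C_iso : iso_closed C)
    (C_contraction : contraction_closed C)
    (C_pendant : pendant_closed C) :
  class_chi_f R C <= limn_esup (fun D : nat => class_chi2 R C D / D%:R%:E) /\
  limn_esup (fun D : nat => class_chi2 R C D / D%:R%:E) <= class_chi R C.
Proof.
by split; [exact: class_chi_f_le_limn_esup | exact: limn_esup_class_chi2_le].
Qed.
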